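(* Let $n\geq t\geq 2$ be integers with $n\equiv t\pmod 2$. A permutation $\pi=\pi_1\cdots\pi_n\in S_n$ is $t$-sorted and has exactly $\frac{n-t}{2}$ descents if and only if its left-to-right maxima are exactly the entries $\pi_1,\pi_3,\pi_5,\ldots,\pi_{n-t+1},\pi_{n-t+2},\pi_{n-t+3},\ldots,\pi_n$. In particular, the number of such permutations in $S_n$ is $(n-t-1)!!$.
   Context: A permutation is a permutation of a finite set of positive integers written in one-line notation; $S_n$ is the set of permutations of $[n]=\{1,\dots,n\}$. West's stack-sorting map $s$ is defined as follows: given an input permutation $\pi=\pi_1\cdots\pi_n$, process it with an initially empty vertical stack; at each step, if the stack is empty or the next entry of the input is smaller than the entry at the top of the stack, push the next input entry onto the stack; otherwise pop the top entry of the stack and append it to the end of the output. When the output has length $n$, this output is $s(\pi)$. $s^t$ denotes the $t$-fold composition of $s$. A permutation is $t$-sorted if it equals $s^t(\mu)$ for some permutation $\mu$. A descent of $\pi$ is an index $i\in[n-1]$ with $\pi_i>\pi_{i+1}$. A left-to-right maximum of $\pi$ is an entry $\pi_j$ that is larger than every entry $\pi_i$ with $i<j$. For odd $m$, $m!!=m(m-2)(m-4)\cdots 1$, and $(-1)!!=1$. *)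

(* Defs.v *)
From mathcomp Require Import all_boot all_order ssralg ssrint.
From mathcomp Require Import classical_sets cardinality.

Set Implicit Arguments.
Unset Strict Implicit.
Unset Printing Implicit Defensive.

(* Permutations are words over the positive integers, in one-line notation. *)
Definition is_perm (p : seq nat) : bool := uniq p && all (fun x => 0 < x) p.

Definition in_S (n : nat) (p : seq nat) : bool := perm_eq p (iota 1 n).

(* 1-based: [entry p i] is p_i for 1 <= i <= size p. *)
Definition entry (p : seq nat) (i : nat) : nat := nth 0 p i.-1.

Record stack_state := StackState {
  st_input : seq nat;
  st_stack : seq nat; (* head = top of the stack *)
  st_output : seq nat
}.

(* The state in which input and stack are both empty is final. *)
Definition stack_step (st : stack_state) : stack_state :=
  let: StackState inp stk out := st in
  match inp, stk with
  | x :: inp', [::] => StackState inp' [:: x] out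
  | x :: inp', y :: stk' =>
      if x < y then StackState inp' (x :: stk) out
      else StackState inp stk' (rcons out y)
  | [::], y :: stk' => StackState [::] stk' (rcons out y)
  | [::], [::] => st
  end.

(* Every entry is pushed once and popped once, so the output reaches length
   [size p] after exactly [2 * size p] steps. *)
Definition stack_sort (p : seq nat) : seq nat :=
  st_output (iter (2 * size p) stack_step (StackState p [::] [::])).

Definition t_sorted (t : nat) (p : seq nat) : Prop :=
  exists2 mu, is_perm mu & p = iter t stack_sort mu.

Definition descents (p : seq nat) : seq nat :=
  [seq i <- iota 1 (size p).-1 | entry p i.+1 < entry p i].

Definition is_ltr_max (p : seq nat) (j : nat) : bool :=
  all (fun i => entry p i < entry p j) (iota 1 j.-1).

Definition ltr_maxima (p : seq nat) : seq nat :=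
  [seq entry p j | j <- iota 1 (size p) & is_ltr_max p j].

Fixpoint dfact (m : nat) : nat :=
  match m with
  | m'.+2 => m * dfact m'
  | _ => 1
  end.

(* Double factorial of an odd integer m >= -1; in particular (-1)!! = 1. *)
Definition dfactz (m : int) : nat :=
  match m with
  | Posz k => dfact k
  | Negz _ => 1
  end.

(* Main.v *)
Require Import Defs.
From mathcomp Require Import all_boot all_order ssralg ssrint zify.
From mathcomp Require Import classical_sets cardinality.

Set Implicit Arguments.
Unset Strict Implicit.
Unset Printing Implicit Defensive.

(* If m is the maximum of l m r then s(l m r) = s(l) s(r) m, so a sorted word of
   length N has fewer than N/2 descents, and s^(t+1)(l m r) = s^t(s(l) s(r)) m.
   Peeling off the last letters in this way reduces the equality case to t = 2,
   that is to s(s(l) s(r)) having the maximal number of descents on an odd number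
   of letters; tightness then forces s(l) s(r) = x m b with a single letter b
   after the maximum m and x again a concatenation of two sorted words, whence
   s(s(l) s(r)) = s(x) b m and induction applies to x.  Conversely, write a word
   with the prescribed left-to-right maxima m_1 < ... < m_K as m_1 c_1 ... m_K c_K
   with blocks c_i of at most one letter, the last t of them empty; shifting all
   blocks one place to the right yields a preimage under s, and this can be done
   t times. *)

(** * The stack machine and the recursion s(l m r) = s(l) s(r) m *)

Definition st_lift (inp stk out : seq nat) (st : stack_state) : stack_state :=
  StackState (st_input st ++ inp) (st_stack st ++ stk) (out ++ st_output st).

(** The number of steps left: a push and a pop for every input letter, a pop for every stacked
    one. *)
Definition st_fuel (st : stack_state) : nat :=
  (size (st_input st)).*2 + size (st_stack st).

Lemma st_fuel_step st : st_fuel (stack_step st) = (st_fuel st).-1.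
Proof.
case: st => [[|x i] [|y k] o]; rewrite /st_fuel //=; first by lia.
by case: ifP => _ /=; lia.
Qed.

Lemma st_fuel0 st : st_fuel st = 0 -> st = StackState [::] [::] (st_output st).
Proof. by case: st => [[|? ?] [|? ?] o]. Qed.

Definition st_all (a : pred nat) (st : stack_state) : bool :=
  all a (st_input st) && all a (st_stack st).

Lemma st_all_step a st : st_all a st -> st_all a (stack_step st).
Proof.
case: st => [[|x i] [|y k] o]; rewrite /st_all //=.
- by case/andP.
- by rewrite andbT => /andP[-> ->].
- by case/andP => /andP[ax ai] /andP[ay ak]; case: ifP => _ /=; rewrite ?ax ai ?ay ak.
Qed.

(** The letters of [st] lie below the top of [stk], so they are pushed as onto an empty stack, and
    below the first letter of [inp], so they are all popped before that letter enters. The default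
    [x.+1] makes either condition vacuous on an empty list. *)
Lemma stack_step_lift inp stk out st :
  st_all (fun x => (x < head x.+1 inp) && (x < head x.+1 stk)) st ->
  0 < st_fuel st ->
  stack_step (st_lift inp stk out st) = st_lift inp stk out (stack_step st).
Proof.
case: st => [[|x i] [|y k] o]; rewrite /st_all /st_lift //=.
- case: inp => [|z inp] /=; first by rewrite rcons_cat.
  case/andP => /andP[yz _] _ _; rewrite ltnNge (ltnW yz) /=.
  by rewrite rcons_cat.
- case: stk => [|z stk] //= /andP[/andP[/andP[_ xz] _] _] _.
  by rewrite xz.
- by move=> _ _; case: ifP => _ //=; rewrite rcons_cat.
Qed.

Lemma iter_stack_step_lift inp stk out m st :
  st_all (fun x => (x < head x.+1 inp) && (x < head x.+1 stk)) st ->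
  m <= st_fuel st ->
  iter m stack_step (st_lift inp stk out st) =
  st_lift inp stk out (iter m stack_step st).
Proof.
elim: m st => [|m IH] st ok lem //; rewrite !iterSr stack_step_lift //.
- by rewrite IH ?st_all_step // st_fuel_step; lia.
- by lia.
Qed.

Lemma iter_stack_step_word inp stk out p :
  all (fun x => (x < head x.+1 inp) && (x < head x.+1 stk)) p ->
  iter (2 * size p) stack_step (StackState (p ++ inp) stk out) =
  StackState inp stk (out ++ stack_sort p).
Proof.
move=> ok; pose st := StackState p [::] [::].
have fuel_st : st_fuel st = 2 * size p by rewrite /st_fuel /= mul2n addn0.
have -> : StackState (p ++ inp) stk out = st_lift inp stk out st.
  by rewrite /st_lift /= cats0.
rewrite iter_stack_step_lift ?fuel_st // /st_all /= ?andbT //.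
(* No fuel remains after [2 * size p] steps, so input and stack are both empty and only the output
   survives. *)
have fuel_iter m : st_fuel (iter m stack_step st) = st_fuel st - m.
  by elim: m => [|m IH] /=; rewrite ?subn0 // st_fuel_step IH; lia.
rewrite (@st_fuel0 (iter _ _ _)) // fuel_iter fuel_st.
by rewrite subnn.
Qed.

(** The letter m forces all of l out before it enters, then lies at the bottom while r is sorted
    above it. The two steps beyond those for l and r are its push and its pop. *)
Lemma stack_sort_max l m r : all (ltn^~ m) l -> all (ltn^~ m) r ->
  stack_sort (l ++ m :: r) = stack_sort l ++ rcons (stack_sort r) m.
Proof.
move=> lm rm; rewrite {1}/stack_sort.
have -> : 2 * size (l ++ m :: r) = (2 * size r).+2 + 2 * size l.
  by rewrite size_cat /=; lia.
rewrite iterD iter_stack_step_word /=; last first.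
  by apply: sub_all lm => x /= ->; rewrite ltnSn.
rewrite -iterS iterSr /= -[in StackState r](cats0 r) iter_stack_step_word /=.
  by rewrite rcons_cat.
by apply: sub_all rm => x /= ->; rewrite ltnSn.
Qed.

Lemma stack_sort_nil : stack_sort [::] = [::].
Proof. by []. Qed.

Lemma uniq_split_max (p : seq nat) : uniq p -> p != [::] ->
  exists l m r, [/\ p = l ++ m :: r, all (ltn^~ m) l & all (ltn^~ m) r].
Proof.
elim: p => [|x [|y p] IH] // /andP[xp up] _; first by exists [::], x, [::].
have [l [m [r [ep lm rm]]]] := IH up isT; rewrite {}ep in xp up *.
have [xm|mx] := ltnP x m; first by exists (x :: l), m, r; rewrite /= xm.
exists [::], x, (l ++ m :: r); split=> //.
have {}mx : m < x.
  rewrite ltn_neqAle mx andbT; apply: contraNneq xp => <-.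
  by rewrite mem_cat inE eqxx orbT.
rewrite all_cat /= mx; apply/andP; split.
  by apply: sub_all lm => z /= zm; apply: ltn_trans mx.
by apply: sub_all rm => z /= zm; apply: ltn_trans mx.
Qed.

Lemma uniq_max_ind (P : seq nat -> Prop) :
  P [::] ->
  (forall (l : seq nat) m r, uniq (l ++ m :: r) -> all (ltn^~ m) l -> all (ltn^~ m) r ->
     P l -> P r -> P (l ++ m :: r)) ->
  forall p : seq nat, uniq p -> P p.
Proof.
move=> P0 PS p; move: {2}(size p).+1 (ltnSn (size p)) => N.
elim: N p => // N IH p szp up; have [->//|/uniq_split_max] := eqVneq p [::].
case/(_ up) => l [m [r [ep lm rm]]]; rewrite {}ep in szp up *.
move: (up); rewrite cat_uniq => /and3P[ul _ /andP[_ ur]].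
move: szp; rewrite size_cat /= => szp.
by apply: PS => //; apply: IH => //; lia.
Qed.

Lemma perm_stack_sort (p : seq nat) : uniq p -> perm_eq (stack_sort p) p.
Proof.
elim/uniq_max_ind => {p} [|l m r _ lm rm pl pr] //.
by rewrite stack_sort_max // perm_cat // perm_rcons perm_cons.
Qed.

Lemma perm_iter_stack_sort t (p : seq nat) : uniq p -> perm_eq (iter t stack_sort p) p.
Proof.
move=> up; elim: t => [|t IH] //=.
by apply: perm_trans (IH); apply: perm_stack_sort; rewrite (perm_uniq IH).
Qed.

Lemma stack_sort_rcons p m : all (ltn^~ m) p ->
  stack_sort (rcons p m) = rcons (stack_sort p) m.
Proof. by move=> pm; rewrite -cats1 stack_sort_max //= cats1. Qed.

Lemma iter_stack_sort_rcons t (p : seq nat) m : uniq p -> all (ltn^~ m) p ->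
  iter t stack_sort (rcons p m) = rcons (iter t stack_sort p) m.
Proof.
move=> up pm; elim: t => [|t IH] //=; rewrite IH stack_sort_rcons //.
by rewrite (perm_all _ (perm_iter_stack_sort t up)).
Qed.

(** * Descents of a stack-sorted word *)

Definition ndes (p : seq nat) : nat := size (descents p).

Lemma entry_rcons p x j : 0 < j <= size p -> entry (rcons p x) j = entry p j.
Proof. by case: j => // j /= jp; rewrite /entry nth_rcons /= jp. Qed.

Lemma entry_rcons_last p x : entry (rcons p x) (size p).+1 = x.
Proof. by rewrite /entry nth_rcons /= ltnn eqxx. Qed.

Lemma ndes_nil : ndes [::] = 0.
Proof. by []. Qed.

Lemma ndes_rcons p x : ndes (rcons p x) = ndes p + (x < last 0 p).
Proof.
case/lastP: p => [|p y] //; rewrite /ndes /descents last_rcons.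
have -> : (size (rcons (rcons p y) x)).-1 = size p + 1 by rewrite !size_rcons addn1.
have -> : (size (rcons p y)).-1 = size p by rewrite size_rcons.
rewrite iotaD filter_cat size_cat; congr (_ + _).
  congr size; apply: eq_in_filter => i; rewrite mem_iota => /andP[i0 ip].
  by rewrite (@entry_rcons (rcons p y) x i.+1) ?(@entry_rcons (rcons p y) x i) // size_rcons; lia.
rewrite add1n /= -{1}(size_rcons p y) entry_rcons_last.
rewrite entry_rcons ?size_rcons ?leqnn // entry_rcons_last.
by case: ifP.
Qed.

(** The defaults make the junction term vanish when either word is empty: nothing is below 0, and
    [last 0 p] is not below itself. *)
Lemma ndes_cat p q :
  ndes (p ++ q) = ndes p + ndes q + (head (last 0 p) q < last 0 p).
Proof.
elim/last_ind: q => [|q x IH]; first by rewrite cats0 /= ltnn !addn0.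
rewrite -rcons_cat !ndes_rcons IH last_cat.
by case: q {IH} => [|y q] /=; rewrite ?ltnn; lia.
Qed.

Lemma ndes_rcons_max p m : all (ltn^~ m) p -> ndes (rcons p m) = ndes p.
Proof.
move=> pm; rewrite ndes_rcons; case/lastP: p pm => [|p x]; first by rewrite addn0.
rewrite all_rcons last_rcons => /andP[/= xm _].
by rewrite ltnNge (ltnW xm) addn0.
Qed.

Lemma ndes_stack_sort_max (l : seq nat) m r : uniq (l ++ m :: r) ->
  all (ltn^~ m) l -> all (ltn^~ m) r ->
  ndes (stack_sort (l ++ m :: r)) =
  ndes (stack_sort l) + ndes (stack_sort r) +
  (head (last 0 (stack_sort l)) (stack_sort r) < last 0 (stack_sort l)).
Proof.
rewrite cat_uniq => /and3P[ul _ /andP[_ ur]] lm rm.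
rewrite stack_sort_max // -rcons_cat ndes_rcons_max ?ndes_cat //.
by rewrite all_cat !(perm_all _ (perm_stack_sort _)) ?lm.
Qed.

(** The final maximum creates no descent, so only the junction of s(l) and s(r) can add one, and
    only if both are nonempty. Twice the descent count then grows by 2, while the strictness of the
    two inductive bounds together with the letter m leaves room for it. *)
Lemma ndes_stack_sort_bound (p : seq nat) :
  uniq p -> p != [::] -> (ndes (stack_sort p)).*2 < size p.
Proof.
elim/uniq_max_ind => {p} [|l m r u lm rm IHl IHr] // _.
rewrite ndes_stack_sort_max // size_cat /=.
case: l r {u lm rm} IHl IHr => [|x l] [|y r] //= IHl IHr.
- by have := IHr isT; rewrite stack_sort_nil ndes_nil /=; lia.
- by have := IHl isT; rewrite stack_sort_nil ndes_nil ltnn; lia.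
- have := IHl isT; have := IHr isT; lia.
Qed.

(** * The shape of the extremal words *)

(* [zigzag k t w]: w has k descents and ends in an increasing run of t
   left-to-right maxima; the non-maxima are isolated and precede this run. *)
Inductive zigzag : nat -> nat -> seq nat -> Prop :=
| zigzag_one x : zigzag 0 1 [:: x]
| zigzag_desc k w b m : zigzag k 1 w -> b < last 0 w -> all (ltn^~ m) w ->
    zigzag k.+1 1 (rcons (rcons w b) m)
| zigzag_asc k t w m : 0 < t -> zigzag k t w -> all (ltn^~ m) w ->
    zigzag k t.+1 (rcons w m).

Lemma size_zigzag k t w : zigzag k t w -> size w = k.*2 + t.
Proof.
by elim=> [x|{}k {}w b m _ IH _ _|{}k {}t {}w m _ _ IH _];
  rewrite ?size_rcons ?IH /=; lia.
Qed.

Lemma zigzag_neq0 k t w : zigzag k t w -> w != [::].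
Proof. by case=> // *; apply/negP => /eqP/(congr1 size); rewrite size_rcons. Qed.

Lemma neq_nil (w : seq nat) : (w != [::]) = (0 < size w).
Proof. by case: w. Qed.

Lemma mem_last0 w : w != [::] -> last 0 w \in w.
Proof. by case: w => // x w _; apply: mem_last. Qed.

Lemma zigzag_desc_all k w b m : zigzag k 1 w -> b < last 0 w ->
  all (ltn^~ m) w -> all (ltn^~ m) (rcons w b).
Proof.
move=> zw bw wm; rewrite all_rcons wm andbT.
apply: ltn_trans bw _; apply: (allP wm); exact: mem_last0 (zigzag_neq0 zw).
Qed.

Lemma zigzag_le_last k t w x : zigzag k t w -> x \in w -> x <= last 0 w.
Proof.
case=> [y|{}k {}w b m zw bw wm|{}k {}t {}w m _ _ wm].
- by rewrite inE => /eqP->.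
- rewrite last_rcons mem_rcons inE => /predU1P[-> //|xw].
  exact/ltnW/(allP (zigzag_desc_all zw bw wm)).
- rewrite last_rcons mem_rcons inE => /predU1P[-> //|xw].
  exact/ltnW/(allP wm).
Qed.

Lemma ndes_zigzag k t w : zigzag k t w -> ndes w = k.
Proof.
elim=> [x|{}k {}w b m zw IH bw wm|{}k {}t {}w m _ _ IH wm] //.
  by rewrite ndes_rcons_max ?(zigzag_desc_all zw) // ndes_rcons IH bw addn1.
by rewrite ndes_rcons_max.
Qed.

(** * Sorted words with the maximal number of descents are zigzags *)

Lemma perm_stack_sort_cat (l r : seq nat) : uniq (l ++ r) ->
  perm_eq (stack_sort l ++ stack_sort r) (l ++ r).
Proof.
rewrite cat_uniq => /and3P[ul _ ur].
exact: perm_cat (perm_stack_sort ul) (perm_stack_sort ur).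
Qed.

Lemma mem_split_max_le (l : seq nat) m r z :
  all (ltn^~ m) l -> all (ltn^~ m) r -> z \in l ++ m :: r -> z <= m.
Proof.
move=> lm rm; rewrite mem_cat inE.
by case/or3P => [/(allP lm)/ltnW|/eqP->|/(allP rm)/ltnW].
Qed.

(** On 2k + 1 letters the bound k is attained, so no slack is left: an empty half or a junction
    without descent would violate the bound on l or r, and r must itself be tight. *)
Lemma ndes_stack_sort_tight k (l : seq nat) m r :
  uniq (l ++ m :: r) -> all (ltn^~ m) l -> all (ltn^~ m) r ->
  0 < k -> size (l ++ m :: r) = k.*2.+1 ->
  ndes (stack_sort (l ++ m :: r)) = k ->
  [/\ l != [::], r != [::],
      head (last 0 (stack_sort l)) (stack_sort r) < last 0 (stack_sort l),
      k = (ndes (stack_sort l) + ndes (stack_sort r)).+1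
    & size r = (ndes (stack_sort r)).*2.+1].
Proof.
move=> u lm rm k0; rewrite ndes_stack_sort_max // size_cat /=.
move: (u); rewrite cat_uniq => /and3P[ul _ /andP[_ ur]].
have := ndes_stack_sort_bound ul; have := ndes_stack_sort_bound ur.
case: (eqVneq l [::]) => [->|l0] /=.
  rewrite stack_sort_nil ndes_nil ltn0.
  case: (eqVneq r [::]) => [->|r0] /= br _; first by clear -k0; lia.
  by move: (br isT); clear -k0; lia.
case: (eqVneq r [::]) => [->|r0] /=.
  rewrite stack_sort_nil ndes_nil ltnn /= => _ /(_ isT).
  by clear -k0; lia.
move=> /(_ isT) br /(_ isT) bl; clear -k0 br bl.
by case: ltnP => _ sz des; split=> //; lia.
Qed.

(* A concatenation of two stack-sorted words ends in the maximum of its second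
   half, so when the word splits at its maximum [m] into two nonempty parts the
   right part is all of [stack_sort r].  That part ends in its own maximum, which
   is incompatible with tightness unless it is a single letter; the left part is
   again a concatenation of two stack-sorted words. *)
Lemma zigzag_stack_sort_cat (l r : seq nat) k :
  uniq (l ++ r) -> size (l ++ r) = k.*2.+1 ->
  let q := stack_sort l ++ stack_sort r in
  ndes (stack_sort q) = k -> zigzag k 1 (stack_sort q).
Proof.
move: {2}(size (l ++ r)).+1 (ltnSn (size (l ++ r))) => N.
elim: N l r k => // N IH l r k szN ulr szk q.
have pq : perm_eq q (l ++ r) by exact: perm_stack_sort_cat.
have uq : uniq q by rewrite (perm_uniq pq).
have szq : size q = k.*2.+1 by rewrite (perm_size pq).
have [|x [m [y [eq_q xm ym]]]] := uniq_split_max uq; first by rewrite neq_nil szq.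
case: (posnP k) => [k0 _|k_gt0].
  move: szq; rewrite k0 eq_q size_cat addnS => -[/eqP]; rewrite addn_eq0.
  by case/andP => /nilP-> /nilP->; apply: zigzag_one.
rewrite eq_q => des_k.
have [||xN0 yN0 xy] := @ndes_stack_sort_tight k x m y _ xm ym k_gt0 _ des_k.
- by rewrite -eq_q.
- by rewrite -eq_q.
move=> eq_k szy.
have [ux uy] : uniq x /\ uniq y.
  by move: uq; rewrite eq_q cat_uniq /= => /and3P[-> _ /andP[_ ->]].
have m_q : m \in q by rewrite eq_q mem_cat inE eqxx orbT.
have y_last c : last c q \in y.
  by rewrite eq_q last_cat /=; case: (y) yN0 => //= z y' _; exact: mem_last.
move: (ulr); rewrite cat_uniq => /and3P[ul _ ur].
have rN0 : r != [::].
  (* If r were empty, q would end in its own maximum, whereas its last letter lies in y, below m. *)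
  apply/eqP => r0; have lN0 : l != [::] by rewrite neq_nil -[l]cats0 -r0 szk.
  have [l1 [a [l2 [el l1a l2a]]]] := uniq_split_max ul lN0.
  have := y_last 0.
  rewrite /q r0 el stack_sort_nil cats0 stack_sort_max // -rcons_cat last_rcons.
  move=> /(allP ym) /=; rewrite ltnNge => /negP; apply.
  by apply: (mem_split_max_le l1a l2a); rewrite -el -[l]cats0 -r0 -(perm_mem pq).
have [r1 [b [r2 [er r1b r2b]]]] := uniq_split_max ur rN0.
have q_last c : last c q = b.
  by rewrite /q er stack_sort_max // last_cat -rcons_cat last_rcons.
have b_y : b \in y by rewrite -(q_last 0).
(* Were m in r, it would be at most the last letter b of q; but b lies in y, hence below m. *)
have m_l : m \in l.
  move: m_q; rewrite (perm_mem pq) mem_cat => /orP[//|].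
  rewrite er => /(mem_split_max_le r1b r2b); rewrite leqNgt => /negP[].
  exact: (allP ym).
have lN0 : l != [::] by case: (l) m_l.
have [l1 [a [l2 [el l1a l2a]]]] := uniq_split_max ul lN0.
have a_m : a = m.
  apply/eqP; rewrite eqn_leq (mem_split_max_le xm ym) /=; last first.
    by rewrite -eq_q (perm_mem pq) el !mem_cat inE eqxx !orbT.
  by apply: (mem_split_max_le l1a l2a); rewrite -el.
rewrite {}a_m in el l1a l2a.
have eq_q2 : q = (stack_sort l1 ++ stack_sort l2) ++ m :: stack_sort r.
  by rewrite /q el stack_sort_max // -rcons_cat cat_rcons.
have m_x : m \notin x by apply/negP => /(allP xm) /=; rewrite ltnn.
have m_l12 : m \notin stack_sort l1 ++ stack_sort l2.
  apply/negP => H; move: uq; rewrite eq_q2 cat_uniq => /and3P[_ /hasPn/(_ m)].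
  by rewrite inE eqxx /= H => /(_ isT).
(* Since m occurs only once in q, the splittings [eq_q] and [eq_q2] cut at the same place, so x and
   y can be compared with s(l1) s(l2) and s(r). *)
have eq_sz : size x = size (stack_sort l1 ++ stack_sort l2).
  have := congr1 (index m) eq_q2; rewrite eq_q !index_cat.
  by rewrite (negPf m_x) (negPf m_l12) /= eqxx !addn0.
have /eqP := eq_q2; rewrite eq_q eqseq_cat // => /andP[/eqP ex /eqP[ey]].
(* As y ends in its maximum b, s(y) has the descents of s(y1) only. Tightness of y then gives y1
   twice as many descents after sorting as letters allow: 2 [ndes (stack_sort y1)] = [size y1],
   against the strict bound. *)
have {}szy : y = [:: b].
  set y1 := stack_sort r1 ++ stack_sort r2; have ey1 : y = rcons y1 b.
    by rewrite ey er stack_sort_max // rcons_cat.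
  have y1b : all (ltn^~ b) y1.
    move: ur; rewrite er cat_uniq /= => /and3P[ur1 _ /andP[_ ur2]].
    by rewrite all_cat !(perm_all _ (perm_stack_sort _)) ?r1b.
  have [y10|y1N0] := eqVneq y1 [::]; first by rewrite ey1 y10.
  have uy1 : uniq y1 by move: uy; rewrite ey1 rcons_uniq => /andP[].
  have := ndes_stack_sort_bound uy1 y1N0.
  move: szy; rewrite ey1 stack_sort_rcons // ndes_rcons_max ?size_rcons; last first.
    by rewrite (perm_all _ (perm_stack_sort _)).
  by case=> ->; rewrite ltnn.
have sb : stack_sort [:: b] = [:: b] by [].
have -> : stack_sort (x ++ m :: y) = rcons (rcons (stack_sort x) b) m.
  by rewrite stack_sort_max // szy sb -!cats1 -catA.
have {}eq_k : k = (ndes (stack_sort x)).+1.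
  by rewrite eq_k szy sb [ndes [:: b]](_ : _ = 0) ?addn0.
have ul12 : uniq (l1 ++ l2).
  by move: ul; rewrite el uniq_catC cons_uniq uniq_catC => /andP[].
have sz12 : size x = size (l1 ++ l2).
  by rewrite eq_sz (perm_size (perm_stack_sort_cat ul12)).
have szx : size x = (ndes (stack_sort x)).*2.+1.
  by move: szq; rewrite eq_q szy eq_k size_cat /= addn2 doubleS => -[].
rewrite [X in zigzag X]eq_k; apply: zigzag_desc.
- rewrite {2}ex; apply: IH => //; rewrite -?sz12 -?ex //.
  by rewrite szx; move: szN; rewrite szk eq_k; clear; lia.
- by move: xy; rewrite szy sb.
- by rewrite (perm_all _ (perm_stack_sort _)).
Qed.

(** Removing the maximum uses up one letter and one application of s and keeps the descents. At t =
    2, one application to a concatenation of two sorted words remains, which is the case already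
    settled. *)
Lemma zigzag_iter_stack_sort k t (mu : seq nat) : 1 < t -> uniq mu -> size mu = k.*2 + t ->
  ndes (iter t stack_sort mu) = k -> zigzag k t (iter t stack_sort mu).
Proof.
case: t => [|[|t]] // _; elim: t mu => [|t IH] mu umu szmu.
all: have [|l [m [r [emu lm rm]]]] := uniq_split_max umu;
  first by rewrite neq_nil; lia.
all: have ulr : uniq (l ++ r)
  by move: umu; rewrite emu uniq_catC cons_uniq uniq_catC => /andP[].
all: have szlr : (size (l ++ r)).+1 = size mu by rewrite emu !size_cat addnS.
all: have pq := perm_stack_sort_cat ulr.
all: have uq : uniq (stack_sort l ++ stack_sort r) by rewrite (perm_uniq pq).
all: have qm : all (ltn^~ m) (stack_sort l ++ stack_sort r)
  by rewrite (perm_all _ pq) all_cat lm.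
all: rewrite iterSr emu stack_sort_max // -rcons_cat iter_stack_sort_rcons //.
all: rewrite ndes_rcons_max ?(perm_all _ (perm_iter_stack_sort _ uq)) // => des_k.
all: apply: zigzag_asc; rewrite ?(perm_all _ (perm_iter_stack_sort _ uq)) //.
  by apply: zigzag_stack_sort_cat => //; lia.
by apply: IH => //; rewrite (perm_size pq); apply: succn_inj; rewrite szlr szmu !addnS.
Qed.

(** * Preimages under s by shifting blocks *)

Definition interleave (ms : seq nat) (cs : seq (seq nat)) : seq nat :=
  flatten [seq x.1 :: x.2 | x <- zip ms cs].

(** These conditions make [ms] the left-to-right maxima of [interleave ms cs], each followed by at
    most one other letter. *)
Definition interleavable (ms : seq nat) (cs : seq (seq nat)) : bool :=
  [&& size ms == size cs, pairwise ltn ms, all (fun c => size c <= 1) cs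
    & all (fun x => all (ltn^~ x.1) x.2) (zip ms cs)].

Lemma interleave_rcons ms cs m c : size ms = size cs ->
  interleave (rcons ms m) (rcons cs c) = interleave ms cs ++ m :: c.
Proof.
by move=> sz; rewrite /interleave zip_rcons // map_rcons flatten_rcons.
Qed.

Lemma interleavable_rcons ms cs m c :
  interleavable (rcons ms m) (rcons cs c) =
  [&& interleavable ms cs, all (ltn^~ m) ms, size c <= 1 & all (ltn^~ m) c].
Proof.
rewrite /interleavable !size_rcons eqSS pairwise_rcons.
have [sz|] //= := eqVneq (size ms) (size cs).
rewrite zip_rcons // !all_rcons /=.
by do !case: (all _ _); do ?case: (pairwise _ _) => //=; case: leqP.
Qed.

Lemma nseqSr (T : Type) n (x : T) : nseq n.+1 x = rcons (nseq n x) x.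
Proof. by elim: n => //= n <-. Qed.

Lemma perm_interleave ms cs : size ms = size cs ->
  perm_eq (interleave ms cs) (ms ++ flatten cs).
Proof.
elim: ms cs => [|m ms IH] [|c cs] //= [sz].
rewrite perm_cons perm_sym perm_catCA perm_cat2l perm_sym; exact: IH.
Qed.

Lemma interleave_shift ms c cs : size ms = (size cs).+1 ->
  c ++ interleave ms (rcons cs [::]) =
  flatten [seq rcons x.2 x.1 | x <- zip ms (c :: cs)].
Proof.
elim: ms c cs => //= m ms IH c [|c' cs] /=.
  by case: ms {IH} => // _; rewrite /interleave /= !cats0 cats1.
by case=> sz; rewrite -IH // /interleave /= cat_rcons.
Qed.

(** The last maximum exceeds everything else, so the recursion splits there; a block of at most one
    letter is fixed by s. Thus s only moves each maximum behind its block. *)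
Lemma stack_sort_interleave ms cs : interleavable ms cs ->
  stack_sort (interleave ms cs) = flatten [seq rcons x.2 x.1 | x <- zip ms cs].
Proof.
elim/last_ind: ms cs => [|ms m IH] cs; first by case: cs.
case/lastP: cs => [|cs c]; first by rewrite /interleavable size_rcons.
rewrite interleavable_rcons => /and4P[ok msm szc cm].
have sz : size ms = size cs by apply/eqP; case/and4P: ok.
rewrite interleave_rcons // stack_sort_max //; last first.
  case/and4P: ok => _ _ _ zok.
  apply/allP => z /flattenP[_ /mapP[[a d] ad ->]] /=.
  have am : a < m.
    apply: (allP msm); rewrite -(@unzip1_zip _ _ ms cs) ?sz //.
    by apply/mapP; exists (a, d).
  by rewrite inE => /predU1P[-> //|/(allP (allP zok _ ad))/ltn_trans]; apply.
rewrite IH // zip_rcons // map_rcons flatten_rcons /=.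
by case: c szc {cm} => [|x [|? ?]].
Qed.

(** A block moved one place to the right follows a larger maximum than before. *)
Lemma interleavable_shift ms cs : interleavable ms (rcons cs [::]) ->
  interleavable ms ([::] :: cs).
Proof.
case/and4P; rewrite size_rcons all_rcons => sz up /andP[_ c1] ok.
apply/and4P; split=> // {c1}.
elim: ms cs sz up ok => [|m ms IH] [|c cs] //=; rewrite ?eqSS.
 move=> sz /andP[mms up] /andP[cm ok].
have := IH cs sz up ok; case: ms mms {IH sz up ok} => [|m' ms] //=.
case/andP=> mm' _ ->; rewrite andbT.
by apply: sub_all cm => z /= zm; apply: ltn_trans mm'.
Qed.

(** Each trailing empty block pays for one preimage: it is dropped at the end and reappears in
    front, which shifts the others to the right. *)
Lemma iter_stack_sort_interleave t ms cs : interleavable ms (cs ++ nseq t [::]) ->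
  interleave ms (cs ++ nseq t [::]) =
  iter t stack_sort (interleave ms (nseq t [::] ++ cs)).
Proof.
elim: t cs => [|t IH] cs; first by rewrite cats0.
have e : cs ++ nseq t.+1 [::] = rcons (cs ++ nseq t [::]) [::].
  by rewrite nseqSr rcons_cat.
rewrite e => ok; have sz : size ms = (size (cs ++ nseq t [::])).+1.
  by case/and4P: ok => /eqP->; rewrite size_rcons.
have := interleave_shift [::] sz; rewrite cat0s => ->.
have ok' := interleavable_shift ok; rewrite -stack_sort_interleave // iterS.
congr stack_sort; rewrite -cat_cons IH //; congr (iter _ _ (interleave _ _)).
by rewrite -cat1s catA cats1 -[RHS]/([::] :: _); elim: t {IH e ok sz ok'} => //= t ->.
Qed.

Lemma pairwise_ltn_last ms m : pairwise ltn ms -> last 0 ms < m ->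
  all (ltn^~ m) ms.
Proof.
case/lastP: ms => // ms a; rewrite pairwise_rcons last_rcons all_rcons.
case/andP => msa _ am; rewrite /= am.
by apply: sub_all msa => z /= za; apply: ltn_trans am.
Qed.

Lemma zigzag_interleave k t w : zigzag k t w ->
  exists ms cs, [/\ w = interleave ms (cs ++ nseq t [::]),
    interleavable ms (cs ++ nseq t [::]) & last 0 ms = last 0 w].
Proof.
elim=> [x|{}k {}w b m zw IH bw wm|{}k {}t {}w m t0 zw IH wm].
- by exists [:: x], [::].
- have [ms [cs []]] := IH; rewrite !cats1.
  case/lastP: ms => [|ms a]; first by rewrite /interleavable size_rcons.
  (* The single trailing empty block, after a, receives b; the new maximum m brings the new empty
     block. *)
  rewrite last_rcons => ew ok ea; exists (rcons (rcons ms a) m), (rcons cs [:: b]).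
  have sz : size ms = size cs.
    by case/and4P: ok; rewrite !size_rcons eqSS => /eqP.
  have am : a < m by rewrite ea; apply: (allP wm); exact: mem_last0 (zigzag_neq0 zw).
  move: ok; rewrite !cats1 !last_rcons interleavable_rcons => /and4P[ok msa _ _].
  split=> //.
    rewrite !interleave_rcons ?size_rcons ?sz // ew interleave_rcons //.
    by rewrite -!cats1 -!catA.
  rewrite !interleavable_rcons ok msa ea /= bw all_rcons /= -ea am !andbT /=.
  by apply: sub_all msa => z /= za; apply: ltn_trans am.
- have [ms [cs [ew ok ems]]] := IH; exists (rcons ms m), cs.
  have /eqP sz : size ms == size (cs ++ nseq t [::]) by case/and4P: ok.
  have -> : cs ++ nseq t.+1 [::] = rcons (cs ++ nseq t [::]) [::].
    by rewrite nseqSr rcons_cat.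
  rewrite !last_rcons interleave_rcons // -ew cats1; split=> //.
  rewrite interleavable_rcons ok /= andbT; apply: pairwise_ltn_last.
    by case/and4P: ok.
  by rewrite ems; apply: (allP wm); exact: mem_last0 (zigzag_neq0 zw).
Qed.

Lemma t_sorted_zigzag k t w : is_perm w -> zigzag k t w -> t_sorted t w.
Proof.
move=> permw /zigzag_interleave[ms [cs [ew ok _]]].
exists (interleave ms (nseq t [::] ++ cs)); last by rewrite ew iter_stack_sort_interleave.
have sz : size ms = size (cs ++ nseq t [::]) by case/and4P: ok => /eqP.
have pw : perm_eq w (interleave ms (nseq t [::] ++ cs)).
  rewrite ew (permPl (perm_interleave sz)) perm_sym.
  have sz' : size ms = size (nseq t ([::] : seq nat) ++ cs).
    by rewrite sz !size_cat addnC.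
  rewrite (permPl (perm_interleave sz')) perm_cat2l !flatten_cat.
  by rewrite perm_catC.
by case/andP: permw => uw w0; rewrite /is_perm -(perm_uniq pw) -(perm_all _ pw) uw.
Qed.

(** * Zigzags in terms of left-to-right maxima *)

Lemma is_ltr_max_rcons p x j : 0 < j <= size p ->
  is_ltr_max (rcons p x) j = is_ltr_max p j.
Proof.
move=> /andP[j0 jp]; rewrite /is_ltr_max entry_rcons ?j0 //.
apply: eq_in_all => i; rewrite mem_iota => /andP[i0 ij].
by rewrite entry_rcons // i0 /=; lia.
Qed.

Lemma is_ltr_max_rcons_last p x :
  is_ltr_max (rcons p x) (size p).+1 = all (ltn^~ x) p.
Proof.
rewrite /is_ltr_max entry_rcons_last /=.
have -> : iota 1 (size p) = map succn (iota 0 (size p)).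
  by rewrite -[1]addn0 iotaDl.
rewrite all_map -[p in RHS](mkseq_nth 0) /mkseq all_map.
apply: eq_in_all => i; rewrite mem_iota add0n => /= ip.
by rewrite entry_rcons.
Qed.

Definition ltr_max_at (a : pred nat) (p : seq nat) : Prop :=
  forall j, 0 < j <= size p -> is_ltr_max p j = a j.

Lemma ltr_max_at_rcons a p x : ltr_max_at a (rcons p x) <->
  ltr_max_at a p /\ all (ltn^~ x) p = a (size p).+1.
Proof.
split=> [H|[Hp Hx] j].
  split=> [j jp|]; last by rewrite -is_ltr_max_rcons_last H // size_rcons ltnSn.
  by rewrite -H ?is_ltr_max_rcons // size_rcons; lia.
rewrite size_rcons => /andP[j0]; rewrite leq_eqVlt => /predU1P[->|jp].
  by rewrite is_ltr_max_rcons_last.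
by rewrite is_ltr_max_rcons ?Hp // j0.
Qed.

Lemma eq_ltr_max_at a b p : (forall j, 0 < j <= size p -> a j = b j) ->
  ltr_max_at a p -> ltr_max_at b p.
Proof. by move=> ab H j jp; rewrite H ?ab. Qed.

(** For n = 2k + t the bound [k.*2.+1] is n - t + 1; odd positions from there on fall under both
    disjuncts, so this is the set of positions in the theorem. *)
Definition zigzag_pos (k j : nat) : bool := odd j || (k.*2.+1 <= j).

Lemma zigzag_ltr_max k t w : zigzag k t w -> ltr_max_at (zigzag_pos k) w.
Proof.
elim=> [x|{}k {}w b m zw IH bw wm|{}k {}t {}w m t0 zw IH wm].
- by case=> [|[|j]].
- have sz := size_zigzag zw; apply/ltr_max_at_rcons; split.
    apply/ltr_max_at_rcons; split.
      by apply: eq_ltr_max_at IH => j; rewrite sz /zigzag_pos; lia.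
    (* The letter b stands at position 2k + 2, which is even and just before the final run. *)
    rewrite sz /zigzag_pos; transitivity false; last by lia.
    apply/negP => /allP/(_ _ (mem_last0 (zigzag_neq0 zw))) /=.
    by rewrite ltnNge (ltnW bw).
  by rewrite (zigzag_desc_all zw) // size_rcons sz /zigzag_pos; lia.
- apply/ltr_max_at_rcons; split=> //.
  by rewrite wm (size_zigzag zw) /zigzag_pos; lia.
Qed.

Lemma ltr_max_zigzag k t (w : seq nat) : uniq w -> 0 < t -> size w = k.*2 + t ->
  ltr_max_at (zigzag_pos k) w -> zigzag k t w.
Proof.
case: t => // t; move=> + _; elim: t w => [|t IHt] w.
  elim: k w => [|k IHk] w.
    by case: w => [|x [|y w]] // _ _ _; apply: zigzag_one.
  case/lastP: w => // w m; case/lastP: w => // w b.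
  rewrite !rcons_uniq mem_rcons inE !size_rcons => /and3P[_ bw uw] szw.
  have {}szw : size w = k.*2 + 1 by lia.
  case/ltr_max_at_rcons => /ltr_max_at_rcons[Hw wb] wm.
  apply: zigzag_desc.
  - by apply: IHk => //; apply: eq_ltr_max_at Hw => j; rewrite szw /zigzag_pos; lia.
  (* Position 2k + 2 is no left-to-right maximum, so some x in w exceeds b; position 2k + 1 is one,
     so the last letter of w is at least x. *)
  - move: wb; rewrite szw [zigzag_pos _ _](_ : _ = false); last first.
      by rewrite /zigzag_pos; lia.
    move/negbT/allPn => [x xw]; rewrite -leqNgt leq_eqVlt => /predU1P[bx|bx].
      by rewrite bx xw in bw.
    apply: leq_trans bx _.
    case/lastP: w xw Hw szw {bw uw wm} => // w y xw.
    case/ltr_max_at_rcons => _ wy; rewrite size_rcons => szw.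
    move: wy; rewrite (_ : zigzag_pos _ _ = true); last first.
      by rewrite /zigzag_pos; lia.
    move=> wy; move: xw; rewrite last_rcons mem_rcons inE => /predU1P[-> //|xw].
    exact/ltnW/(allP wy).
  - move: wm; rewrite size_rcons szw (_ : zigzag_pos _ _ = true).
      by rewrite all_rcons => /andP[].
    by rewrite /zigzag_pos; lia.
case/lastP: w => [|w m]; first by rewrite /= addnS.
rewrite rcons_uniq size_rcons => /andP[_ uw] szw /ltr_max_at_rcons[Hw wm].
apply: zigzag_asc => //; first by apply: IHt => //; lia.
by rewrite wm /zigzag_pos; lia.
Qed.

Lemma zigzagP k t (w : seq nat) : uniq w -> 0 < t -> size w = k.*2 + t ->
  zigzag k t w <-> ltr_max_at (zigzag_pos k) w.
Proof. by move=> uw t0 sz; split; [apply: zigzag_ltr_max | apply: ltr_max_zigzag]. Qed.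

(** Entries are distinct, so a set of values determines the set of positions. *)
Lemma ltr_maximaP (a : pred nat) (p : seq nat) : uniq p ->
  ltr_maxima p =i [seq entry p j | j <- iota 1 (size p) & a j] <->
  ltr_max_at a p.
Proof.
move=> up; have mem_entry (b : pred nat) j : 0 < j <= size p ->
    (entry p j \in [seq entry p i | i <- iota 1 (size p) & b i]) = b j.
  move=> jp; apply/mapP/idP => [[i]|bj]; last first.
    by exists j => //; rewrite mem_filter bj mem_iota add1n ltnS.
  rewrite mem_filter mem_iota add1n ltnS; case: i j jp => [|i] [|j] //= jp.
    by rewrite andbF.
  by case/andP=> bi ip /eqP; rewrite /entry nth_uniq // => /eqP /= ->.
split=> [H j jp|H x].
  by rewrite -(mem_entry a) // -H mem_entry.
congr (x \in map _ _); apply: eq_in_filter => j.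
by rewrite mem_iota add1n ltnS; apply: H.
Qed.

(** * Enumerating and counting zigzags *)

Definition maxs (s : seq nat) : nat := \max_(x <- s) x.

Lemma maxs_eq (s : seq nat) m : m \in s -> (forall x, x \in s -> x <= m) ->
  maxs s = m.
Proof.
move=> ms le_m; apply/eqP; rewrite eqn_leq (@leq_bigmax_seq _ _ xpredT id) // andbT.
by apply/bigmax_leqP_seq => x xs _; apply: le_m.
Qed.

Lemma maxs_rcons (w s : seq nat) m : perm_eq (rcons w m) s -> all (ltn^~ m) w ->
  maxs s = m.
Proof.
move=> pw wm; apply: maxs_eq => [|x]; rewrite -(perm_mem pw) mem_rcons inE ?eqxx //.
by case/predU1P => [-> //|/(allP wm)/ltnW].
Qed.

Lemma maxs_mem (s : seq nat) : s != [::] -> maxs s \in s.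
Proof.
rewrite /maxs; elim: s => // x [|y s] IH _; first by rewrite big_seq1 inE.
rewrite big_cons /maxn inE; case: ifP => _; last by rewrite eqxx.
by rewrite IH // orbT.
Qed.

Lemma maxs_ge (s : seq nat) x : x \in s -> x <= maxs s.
Proof. by move=> xs; apply: (@leq_bigmax_seq _ _ xpredT id). Qed.

Lemma perm_rcons_rem (s w : seq nat) m : m \in s ->
  perm_eq (rcons w m) s = perm_eq w (rem m s).
Proof.
move=> ms; rewrite (permPr (perm_to_rem ms)) -[RHS](perm_cons m).
exact: perm_rcons.
Qed.

Lemma all_rem_maxs (s : seq nat) : uniq s -> all (ltn^~ (maxs s)) (rem (maxs s) s).
Proof.
move=> us; apply/allP => x; rewrite mem_rem_uniq // inE => /andP[xm xs] /=.
by rewrite ltn_neqAle xm maxs_ge.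
Qed.

(** The maximum of s comes last. The letter b before it must be below the last letter of w, which is
    the largest of the rest; so b is anything but the two largest letters of s. *)
Fixpoint zigzags1 (k : nat) (s : seq nat) : seq (seq nat) :=
  if k is k'.+1 then
    let s' := rem (maxs s) s in
    [seq rcons (rcons w b) (maxs s) | b <- rem (maxs s') s', w <- zigzags1 k' (rem b s')]
  else [:: s].

(* Off by one: [zigzags k t s] lists the arrangements of s that satisfy
   [zigzag k t.+1]. *)
Fixpoint zigzags (k t : nat) (s : seq nat) : seq (seq nat) :=
  if t is t'.+1 then [seq rcons w (maxs s) | w <- zigzags k t' (rem (maxs s) s)]
  else zigzags1 k s.

Lemma size_rem_maxs (s : seq nat) n : size s = n.+1 -> size (rem (maxs s) s) = n.
Proof.
by move=> sz; rewrite size_rem ?sz // maxs_mem //; case: s sz.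
Qed.

Lemma mem_zigzags1 k (s p : seq nat) : uniq s -> size s = k.*2.+1 ->
  p \in zigzags1 k s <-> perm_eq p s /\ zigzag k 1 p.
Proof.
elim: k s p => [|k IH] s p us szs.
  case: s us szs => [|x [|y s]] // _ _; rewrite inE; split.
    by move/eqP->; split=> //; apply: zigzag_one.
  by case=> /perm_small_eq -> .
have s0 : s != [::] by case: s szs {us}.
have szs' := size_rem_maxs szs; have us' := rem_uniq (maxs s) us.
have s'm := all_rem_maxs us; have ms := maxs_mem s0.
rewrite /=; move: (rem (maxs s) s) szs' us' s'm (fun w => perm_rcons_rem w ms).
move=> s' szs' us' s'm perm_s.
have s'0 : s' != [::] by case: s' szs' {us' s'm perm_s}.
have ms' := maxs_mem s'0.
have szr b : b \in s' -> size (rem b s') = k.*2.+1 by move=> bs'; rewrite size_rem ?szs'.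
split.
  case/allpairsPdep => b [w [+ + ->]]; rewrite mem_rem_uniq // inE => /andP[bm bs'].
  case/IH; rewrite ?rem_uniq ?szr // => pw zw.
  (* The maximum of s' differs from b, so it remains in w and is at most the last letter of w. *)
  have bw : b < last 0 w.
    apply: leq_trans (_ : b < maxs s') _; first by rewrite ltn_neqAle bm maxs_ge.
    apply: (zigzag_le_last zw); rewrite (perm_mem pw) mem_rem_uniq // inE ms' andbT.
    by rewrite eq_sym.
  have pwb : perm_eq (rcons w b) s' by rewrite perm_rcons_rem.
  rewrite perm_s pwb; split=> //; apply: zigzag_desc => //.
  by move: s'm; rewrite -(perm_all _ pwb) all_rcons => /andP[].
(* The indices are generalized to allow inversion of [zigzag k.+1 1 p]. *)
case=> + zp; move Et: 1 zp => t zp; move Ek: k.+1 zp => k1 zp.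
case: zp Et Ek => [//|k2 w b m zw bw wm _ [ek]|k2 t2 w m t0 _ _ [e]]; last first.
  by rewrite -e in t0.
rewrite -{}ek in zw => pw.
have em := maxs_rcons pw (zigzag_desc_all zw bw wm).
move: pw; rewrite -{1}em perm_s => pwb.
have bs' : b \in s' by rewrite -(perm_mem pwb) mem_rcons mem_head.
apply/allpairsPdep; exists b, w; rewrite em; split=> //.
  rewrite mem_rem_uniq // inE bs' andbT.
  have lw : last 0 w \in s'.
    by rewrite -(perm_mem pwb) mem_rcons inE mem_last0 ?orbT // (zigzag_neq0 zw).
  by apply: contraTneq bw => ->; rewrite -leqNgt maxs_ge.
apply/IH; rewrite ?rem_uniq ?szr //; split=> //.
by rewrite -perm_rcons_rem.
Qed.

Lemma mem_zigzags k t (s p : seq nat) : uniq s -> size s = k.*2 + t.+1 ->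
  p \in zigzags k t s <-> perm_eq p s /\ zigzag k t.+1 p.
Proof.
elim: t s p => [|t IH] s p us szs; first by apply: mem_zigzags1; rewrite // szs addn1.
have ms : maxs s \in s by apply: maxs_mem; rewrite neq_nil szs addnS.
have us' := rem_uniq (maxs s) us; have s'm := all_rem_maxs us.
have szs' : size (rem (maxs s) s) = k.*2 + t.+1.
  by apply: size_rem_maxs; rewrite szs addnS.
split=> [/mapP[w + ->]|[]].
  case/IH => // pw zw; rewrite perm_rcons_rem //; split=> //.
  by apply: zigzag_asc; rewrite ?(perm_all _ pw).
move=> + zp; move Et: t.+2 zp => t1 zp.
case: zp Et => [//|//|{}k' t2 w m t0 zw wm [et]] in IH szs szs' * => pw.
rewrite -{}et in zw; have em := maxs_rcons pw wm.
apply/mapP; exists w; rewrite em //; apply/IH; rewrite -?em //.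
by split=> //; rewrite -perm_rcons_rem // em.
Qed.

Lemma zigzags1_uniq k (s : seq nat) : uniq s -> uniq (zigzags1 k s).
Proof.
elim: k s => //= k IH s us; apply: allpairs_uniq_dep.
- by rewrite !rem_uniq.
- by move=> b _; rewrite IH // !rem_uniq.
- move=> [b w] [b' w'] _ _ /= /rcons_inj[/rcons_inj[-> ->]].
  by [].
Qed.

Lemma zigzags_uniq k t (s : seq nat) : uniq s -> uniq (zigzags k t s).
Proof.
elim: t s => [|t IH] s us /=; first exact: zigzags1_uniq.
by rewrite map_inj_uniq ?IH ?rem_uniq // => w w' /rcons_inj[].
Qed.

Lemma dfact_odd k : dfact k.*2.+1 = k.*2.+1 * dfact k.*2.-1.
Proof. by case: k. Qed.

(** At stage k + 1 there are 2k + 1 choices of b, each with (2k - 1)!! completions. For k = 0 the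
    truncated [k.*2.-1] is 0, and [dfact 0] agrees with (-1)!!. *)
Lemma size_zigzags1 k (s : seq nat) : size s = k.*2.+1 ->
  size (zigzags1 k s) = dfact k.*2.-1.
Proof.
elim: k s => [|k IH] s szs //; rewrite [zigzags1 _ _]/= size_allpairs_dep.
have szs' := size_rem_maxs szs.
have szs'' := size_rem_maxs szs'.
move: (rem (maxs s) s) szs' szs'' => s' szs' szs''.
rewrite doubleS [_.+2.-1]/= dfact_odd -szs''.
(* Only membership in s' matters for the size of a summand, so the list of choices can be
   generalized for the induction. *)
have: {subset rem (maxs s') s' <= s'} by move=> b; apply: mem_rem.
elim: (rem _ _) => //= b r IHr rs; rewrite mulSn -IHr => [|x xr].
  by rewrite IH // size_rem ?szs' // rs ?mem_head.
by rewrite rs // inE xr orbT.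
Qed.

Lemma size_zigzags k t (s : seq nat) : size s = k.*2 + t.+1 ->
  size (zigzags k t s) = dfact k.*2.-1.
Proof.
elim: t s => [|t IH] s szs /=; first by rewrite size_zigzags1 // szs addn1.
by rewrite size_map IH //; apply: size_rem_maxs; rewrite szs addnS.
Qed.

Lemma card_eq_seq (T : choiceType) (s : seq T) : uniq s ->
  ([set` s] #= `I_(size s))%classic%card.
Proof.
elim: s => [|x s IH] /=.
  by rewrite set_nil II0 card_eq00.
case/andP => xs us; apply/eq_cardSP; exists x; first by rewrite /= inE eqxx.
rewrite (_ : _ `\ _ = [set` s])%classic ?IH //.
apply/seteqP; split=> y /=; rewrite inE.
  by case=> /predU1P[->|].
by move=> ys; split; [rewrite ys orbT | move=> e; rewrite -e ys in xs].
Qed.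

Theorem theorem3 (n t : nat) (ht : 2 <= t) (hn : t <= n)
    (hpar : n = t %[mod 2]) :
  (forall p : seq nat, in_S n p ->
     (t_sorted t p /\ size (descents p) = (n - t) %/ 2) <->
     ltr_maxima p =i
       [seq entry p j | j <- iota 1 n
                      & (odd j && (j <= n - t + 1)) || (n - t + 1 <= j)]) /\
  ([set p : seq nat | [/\ in_S n p, t_sorted t p
                        & size (descents p) = (n - t) %/ 2]]
     #= `I_(dfactz (n%:Z - t%:Z - 1)%R))%classic%card.
Proof.
have [k nk] : exists k, n = k.*2 + t.
  by exists ((n - t) %/ 2); move: hpar hn; rewrite -muln2; lia.
have -> : (n - t) %/ 2 = k by rewrite nk addnK -muln2 mulnK.
(* Both claims reduce to this equivalence with [zigzag k t]. *)
have sortedP p : in_S n p -> t_sorted t p /\ ndes p = k <-> zigzag k t p.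
  move=> pn; have up : uniq p by rewrite (perm_uniq pn) iota_uniq.
  have szp : size p = k.*2 + t by rewrite (perm_size pn) size_iota nk.
  split=> [[[mu /andP[umu _] emu] des_k]|zp].
    have szmu : size mu = k.*2 + t.
      by rewrite -szp emu (perm_size (perm_iter_stack_sort _ umu)).
    by rewrite emu; apply: zigzag_iter_stack_sort; rewrite -?emu.
  split; last exact: ndes_zigzag zp.
  apply: t_sorted_zigzag zp; rewrite /is_perm up (perm_all _ pn).
  by apply/allP => x; rewrite mem_iota => /andP[].
split=> [p pn|].
  have up : uniq p by rewrite (perm_uniq pn) iota_uniq.
  have szp : size p = n by rewrite (perm_size pn) size_iota.
  rewrite -/(ndes p) sortedP // zigzagP ?szp //; last by lia.
  rewrite -(ltr_maximaP _ up) szp.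
  suff -> : [seq j <- iota 1 n | zigzag_pos k j] =
    [seq j <- iota 1 n | odd j && (j <= n - t + 1) || (n - t + 1 <= j)] by [].
  by apply: eq_filter => j; rewrite /zigzag_pos nk addnK; lia.
(* The final run has length [t.+1] from here on, to fit the offset in [zigzags]. *)
case: t ht hn hpar nk sortedP => // t _ _ _ nk sortedP.
have -> : [set p | [/\ in_S n p, t_sorted t.+1 p & size (descents p) = k]]%classic =
          [set` zigzags k t (iota 1 n)]%classic.
  apply/seteqP; split=> p /=; rewrite mem_zigzags ?iota_uniq ?size_iota //.
    by case=> pn ps pd; split=> //; apply/sortedP.
  by case=> pn /sortedP[].
have -> : dfactz (n%:Z - t.+1%:Z - 1)%R = size (zigzags k t (iota 1 n)).
  rewrite size_zigzags ?size_iota // nk.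
  have -> : ((k.*2 + t.+1)%:Z - t.+1%:Z - 1 = k.*2%:Z - 1)%R by lia.
  (* For k = 0 the integer is -1, which [dfactz] sends to 1. *)
  by case: k {nk sortedP} => [|k] //; rewrite doubleS -predn_int.
by apply: card_eq_seq; apply: zigzags_uniq; apply: iota_uniq.
Qed.
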